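(* Let $V$ be an $L$-module with $\dim V=2$. Then $V$ is indecomposable if and only if it is isomorphic to a module in one, and only one, of the following families (with $a,b\in\Bbbk^{\times}$): $\mathcal{U}_{a,b}$, or $\mathcal{V}_a^2$, or $\mathcal{W}_a$.
   Context: $\Bbbk$ is an algebraically closed field of characteristic $0$. $L$ is the $\Bbbk$-algebra generated by $y$ and $g^{\pm 1}$ with relations $gg^{-1}=g^{-1}g=1$ and $gyg^{-1}=-y$. For $a,b\in\Bbbk^\times$ the following are $L$-modules on $\Bbbk^2$: $\mathcal{U}_{a,b}$: $g\mapsto \begin{pmatrix} a&0\\0&-a\end{pmatrix}$, $y\mapsto \begin{pmatrix}0&b\\1&0\end{pmatrix}$; $\mathcal{V}_a^2$: $g\mapsto\begin{pmatrix}a&1\\0&a\end{pmatrix}$, $y\mapsto 0$; $\mathcal{W}_a$: $g\mapsto \begin{pmatrix} a&0\\0&-a\end{pmatrix}$, $y\mapsto \begin{pmatrix}0&1\\0&0\end{pmatrix}$. *)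

(* Defs.v *)
From HB Require Import structures.
From mathcomp Require Import all_boot all_order all_algebra.
From mathcomp Require Import boolp.

Set Implicit Arguments.
Unset Strict Implicit.
Unset Printing Implicit Defensive.

Import GRing.Theory.
Local Open Scope ring_scope.
Local Open Scope quotient_scope.

(* L is defined by its presentation: noncommutative polynomial expressions in  *)
(* g, g^-1, y with coefficients in k, modulo the least congruence containing   *)
(* the k-algebra laws and the defining relations (Leqv_gV to Leqv_gyV).      *)
(* The element - t of L is represented by Lmul (Lcst (-1)) t.                  *)

Inductive Lterm (k : Type) : Type :=
  | Lcst of k
  | Lg_t
  | LgV_t
  | Ly_t
  | Ladd of Lterm k & Lterm k
  | Lmul of Lterm k & Lterm k.
Arguments Lg_t {k}.
Arguments LgV_t {k}.
Arguments Ly_t {k}.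

HB.instance Definition _ (k : Type) := gen_eqMixin (Lterm k).
HB.instance Definition _ (k : Type) := gen_choiceMixin (Lterm k).

Inductive Leqv (k : fieldType) : Lterm k -> Lterm k -> Prop :=
  | Leqv_refl t : Leqv t t
  | Leqv_sym t s : Leqv t s -> Leqv s t
  | Leqv_trans s t r : Leqv t s -> Leqv s r -> Leqv t r
  | Leqv_add t t' s s' : Leqv t t' -> Leqv s s' -> Leqv (Ladd t s) (Ladd t' s')
  | Leqv_mul t t' s s' : Leqv t t' -> Leqv s s' -> Leqv (Lmul t s) (Lmul t' s')
  | Leqv_addA t s r : Leqv (Ladd t (Ladd s r)) (Ladd (Ladd t s) r)
  | Leqv_addC t s : Leqv (Ladd t s) (Ladd s t)
  | Leqv_add0 t : Leqv (Ladd (Lcst 0) t) t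
  | Leqv_mulA t s r : Leqv (Lmul t (Lmul s r)) (Lmul (Lmul t s) r)
  | Leqv_mul0l t : Leqv (Lmul (Lcst 0) t) (Lcst 0)
  | Leqv_mul1l t : Leqv (Lmul (Lcst 1) t) t
  | Leqv_mulDl t s r : Leqv (Lmul (Ladd t s) r) (Ladd (Lmul t r) (Lmul s r))
  | Leqv_mulDr t s r : Leqv (Lmul t (Ladd s r)) (Ladd (Lmul t s) (Lmul t r))
  | Leqv_cstD a b : Leqv (Ladd (Lcst a) (Lcst b)) (Lcst (a + b))
  | Leqv_cstM a b : Leqv (Lmul (Lcst a) (Lcst b)) (Lcst (a * b))
  | Leqv_cstC a t : Leqv (Lmul (Lcst a) t) (Lmul t (Lcst a))
  | Leqv_gV : Leqv (Lmul Lg_t LgV_t) (Lcst 1)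
  | Leqv_Vg : Leqv (Lmul LgV_t Lg_t) (Lcst 1)
  | Leqv_gyV : Leqv (Lmul (Lmul Lg_t Ly_t) LgV_t) (Lmul (Lcst (-1)) Ly_t).

Section Algebra.
Variable k : fieldType.
Implicit Types t s r : Lterm k.

Definition Leqvb : rel (Lterm k) := fun t s => `[< Leqv t s >].

Lemma Leqvb_equiv : equiv_class_of Leqvb.
Proof.
split=> [t|t s|s t r]; first exact/asboolP/Leqv_refl.
- by apply/idP/idP => /asboolP h; apply/asboolP/Leqv_sym.
- by move=> /asboolP h1 /asboolP h2; apply/asboolP/(Leqv_trans h1).
Qed.

Canonical Leqvb_equiv_rel := EquivRelPack Leqvb_equiv.
Canonical Leqvb_encModRel := defaultEncModRel Leqvb.

Definition L : Type := {eq_quot Leqvb}.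
HB.instance Definition _ := Choice.on L.
HB.instance Definition _ := EqQuotient.on L.

Lemma LpiP t s : Leqv t s <-> \pi_L t = \pi_L s.
Proof.
split=> [h|/eqP]; first by apply/eqP; rewrite piE; apply/asboolP.
by rewrite piE => /asboolP.
Qed.

Lemma Lrepr t : Leqv (repr (\pi_L t)) t.
Proof. by apply/LpiP; rewrite reprK. Qed.

Definition Lzero : L := \pi_L (Lcst 0).
Definition Lone : L := \pi_L (Lcst 1).
Definition Lplus (u v : L) : L := \pi_L (Ladd (repr u) (repr v)).
Definition Ltimes (u v : L) : L := \pi_L (Lmul (repr u) (repr v)).
Definition Lopp (u : L) : L := \pi_L (Lmul (Lcst (-1)) (repr u)).
Definition Lscale (a : k) (u : L) : L := \pi_L (Lmul (Lcst a) (repr u)).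

Lemma LplusE t s : Lplus (\pi_L t) (\pi_L s) = \pi_L (Ladd t s).
Proof. by apply/LpiP/Leqv_add; apply: Lrepr. Qed.
Lemma LtimesE t s : Ltimes (\pi_L t) (\pi_L s) = \pi_L (Lmul t s).
Proof. by apply/LpiP/Leqv_mul; apply: Lrepr. Qed.
Lemma LoppE t : Lopp (\pi_L t) = \pi_L (Lmul (Lcst (-1)) t).
Proof. by apply/LpiP/Leqv_mul; [apply: Leqv_refl|apply: Lrepr]. Qed.
Lemma LscaleE a t : Lscale a (\pi_L t) = \pi_L (Lmul (Lcst a) t).
Proof. by apply/LpiP/Leqv_mul; [apply: Leqv_refl|apply: Lrepr]. Qed.

Lemma LplusA : associative Lplus.
Proof.
elim/quotW=> t; elim/quotW=> s; elim/quotW=> r.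
rewrite (LplusE s r) (LplusE t s) (LplusE t) (LplusE _ r).
exact/LpiP/Leqv_addA.
Qed.
Lemma LplusC : commutative Lplus.
Proof.
by elim/quotW=> t; elim/quotW=> s; rewrite (LplusE t) (LplusE s);
  apply/LpiP/Leqv_addC.
Qed.
Lemma Lplus0 : left_id Lzero Lplus.
Proof. by elim/quotW=> t; rewrite LplusE; apply/LpiP/Leqv_add0. Qed.
Lemma LplusN : left_inverse Lzero Lopp Lplus.
Proof.
elim/quotW=> t; rewrite (LoppE t) LplusE; apply/LpiP.
apply: Leqv_trans (Leqv_mul0l t); rewrite -(addNr (1 : k)).
apply: Leqv_sym; apply: Leqv_trans.
  by apply: Leqv_mul (Leqv_refl t); apply: Leqv_sym; apply: Leqv_cstD.
apply: Leqv_trans (Leqv_mulDl _ _ _) _.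
by apply: Leqv_add; [apply: Leqv_refl|apply: Leqv_mul1l].
Qed.
HB.instance Definition _ :=
  GRing.isZmodule.Build L LplusA LplusC Lplus0 LplusN.

Lemma LtimesA : associative Ltimes.
Proof.
elim/quotW=> t; elim/quotW=> s; elim/quotW=> r.
rewrite (LtimesE s r) (LtimesE t s) (LtimesE t) (LtimesE _ r).
exact/LpiP/Leqv_mulA.
Qed.
Lemma Ltimes1l : left_id Lone Ltimes.
Proof. by elim/quotW=> t; rewrite LtimesE; apply/LpiP/Leqv_mul1l. Qed.
Lemma Ltimes1r : right_id Lone Ltimes.
Proof.
elim/quotW=> t; rewrite LtimesE; apply/LpiP.
exact: Leqv_trans (Leqv_sym (Leqv_cstC _ _)) (Leqv_mul1l _).
Qed.
Lemma LtimesDl : left_distributive Ltimes Lplus.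
Proof.
elim/quotW=> t; elim/quotW=> s; elim/quotW=> r.
rewrite (LplusE t s) (LtimesE _ r) (LtimesE t r) (LtimesE s r) LplusE.
exact/LpiP/Leqv_mulDl.
Qed.
Lemma LtimesDr : right_distributive Ltimes Lplus.
Proof.
elim/quotW=> t; elim/quotW=> s; elim/quotW=> r.
rewrite (LplusE s r) (LtimesE t _) (LtimesE t s) (LtimesE t r) LplusE.
exact/LpiP/Leqv_mulDr.
Qed.

(* Interpretation of expressions in a ring containing scalars from k; used for *)
(* the nontriviality of L and for the universal property Leval below.          *)
Fixpoint Lterm_eval (A : pzRingType) (c : k -> A) (G GV Y : A) (t : Lterm k)
    : A :=
  match t with
  | Lcst a => c a
  | Lg_t => G
  | LgV_t => GV
  | Ly_t => Y
  | Ladd s r => Lterm_eval c G GV Y s + Lterm_eval c G GV Y r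
  | Lmul s r => Lterm_eval c G GV Y s * Lterm_eval c G GV Y r
  end.

Lemma Lterm_eval_eqv (A : pzRingType) (c : {rmorphism k -> A}) (G GV Y : A) :
    (forall a x, c a * x = x * c a) ->
    G * GV = 1 -> GV * G = 1 -> G * Y * GV = - Y ->
  forall t s, Leqv t s -> Lterm_eval c G GV Y t = Lterm_eval c G GV Y s.
Proof.
move=> cC GK VK GY t s; elim=> //=.
- by move=> {}s {}t r _ -> _ ->.
- by move=> ? ? ? ? _ -> _ ->.
- by move=> ? ? ? ? _ -> _ ->.
- by move=> *; rewrite addrA.
- by move=> *; rewrite addrC.
- by move=> *; rewrite rmorph0 add0r.
- by move=> *; rewrite mulrA.
- by move=> *; rewrite rmorph0 mul0r.
- by move=> *; rewrite rmorph1 mul1r.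
- by move=> *; rewrite mulrDl.
- by move=> *; rewrite mulrDr.
- by move=> *; rewrite rmorphD.
- by move=> *; rewrite rmorphM.
- by rewrite rmorph1.
- by rewrite rmorph1.
- by rewrite rmorphN rmorph1 mulN1r.
Qed.

Lemma Lone_neq0 : Lone != 0.
Proof.
apply/eqP => /LpiP h.
have /eqP := @Lterm_eval_eqv k idfun 1 1 0 (@mulrC k) (mulr1 1) (mulr1 1)
  (etrans (mulr1 _) (etrans (mulr0 1) (esym (@oppr0 k)))) _ _ h.
by rewrite /= oner_eq0.
Qed.
HB.instance Definition _ :=
  GRing.Zmodule_isNzRing.Build L LtimesA Ltimes1l Ltimes1r LtimesDl LtimesDr
    Lone_neq0.

Lemma LscaleA a b u : Lscale a (Lscale b u) = Lscale (a * b) u.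
Proof.
elim/quotW: u => t; rewrite (LscaleE b t) !(LscaleE _ _); apply/LpiP.
by apply: Leqv_trans (Leqv_mulA _ _ _) _; apply: Leqv_mul (Leqv_refl t);
   apply: Leqv_cstM.
Qed.
Lemma Lscale1 : left_id 1 Lscale.
Proof. by elim/quotW=> t; rewrite LscaleE; apply/LpiP/Leqv_mul1l. Qed.
Lemma LscaleDr : right_distributive Lscale +%R.
Proof.
move=> a; elim/quotW=> t; elim/quotW=> s; rewrite -[+%R]/Lplus.
rewrite (LplusE t s) (LscaleE _ (Ladd _ _)) (LscaleE a t) (LscaleE a s) LplusE.
exact/LpiP/Leqv_mulDr.
Qed.
Lemma LscaleDl u : {morph Lscale^~ u : a b / a + b}.
Proof.
move=> a b; elim/quotW: u => t; rewrite -[X in _ = X]/(Lplus _ _).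
rewrite (LscaleE (a + b) t) (LscaleE a t) (LscaleE b t) LplusE.
apply/LpiP/Leqv_sym; apply: Leqv_trans (Leqv_sym (Leqv_mulDl _ _ _)) _.
by apply: Leqv_mul (Leqv_refl t); apply: Leqv_cstD.
Qed.
HB.instance Definition _ :=
  GRing.Zmodule_isLmodule.Build k L LscaleA Lscale1 LscaleDr LscaleDl.

Lemma LscaleAl (a : k) (u v : L) : a *: (u * v) = (a *: u) * v.
Proof.
elim/quotW: u => t; elim/quotW: v => s.
change (Lscale a (Ltimes (\pi_L t) (\pi_L s)) =
  Ltimes (Lscale a (\pi_L t)) (\pi_L s)).
rewrite (LtimesE t s) (LscaleE a t) (LscaleE a _) (LtimesE _ s).
exact/LpiP/Leqv_mulA.
Qed.
HB.instance Definition _ := GRing.Lmodule_isLalgebra.Build k L LscaleAl.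

Lemma LscaleAr (a : k) (u v : L) : a *: (u * v) = u * (a *: v).
Proof.
elim/quotW: u => t; elim/quotW: v => s.
change (Lscale a (Ltimes (\pi_L t) (\pi_L s)) =
  Ltimes (\pi_L t) (Lscale a (\pi_L s))).
rewrite (LtimesE t s) (LscaleE a s) (LscaleE a _) (LtimesE t _); apply/LpiP.
apply: Leqv_trans (Leqv_mulA _ _ _) _.
apply: Leqv_trans (Leqv_sym (Leqv_mulA _ _ _)).
exact: Leqv_mul (Leqv_cstC _ _) (Leqv_refl _).
Qed.
HB.instance Definition _ := GRing.Lalgebra_isAlgebra.Build k L LscaleAr.

Definition Lg : L := \pi_L Lg_t.
Definition LgV : L := \pi_L LgV_t.
Definition Ly : L := \pi_L Ly_t.

Lemma LgK : Lg * LgV = 1.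
Proof. by rewrite -[LHS]/(Ltimes _ _) LtimesE; apply/LpiP/Leqv_gV. Qed.
Lemma LgVK : LgV * Lg = 1.
Proof. by rewrite -[LHS]/(Ltimes _ _) LtimesE; apply/LpiP/Leqv_Vg. Qed.
Lemma LgyV : Lg * Ly * LgV = - Ly.
Proof.
rewrite -[LHS]/(Ltimes (Ltimes Lg Ly) LgV) -[RHS]/(Lopp Ly).
rewrite (LtimesE Lg_t Ly_t) LtimesE (LoppE Ly_t).
exact/LpiP/Leqv_gyV.
Qed.

(* Universal property of L: a triple satisfying the defining relations in a    *)
(* k-algebra A extends to an algebra morphism L -> A.                          *)
Record Ltriple (A : algType k) := LTriple {
  Ltg : A;
  LtgV : A;
  Lty : A;
  LtgK : Ltg * LtgV = 1;
  LtgVK : LtgV * Ltg = 1;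
  LtgyV : Ltg * Lty * LtgV = - Lty }.

Definition Leval (A : algType k) (d : Ltriple A) (u : L) : A :=
  Lterm_eval (in_alg A) (Ltg d) (LtgV d) (Lty d) (repr u).

Section Eval.
Variables (A : algType k) (d : Ltriple A).

Lemma Leval_pi t :
  Leval d (\pi_L t) = Lterm_eval (in_alg A) (Ltg d) (LtgV d) (Lty d) t.
Proof.
apply: Lterm_eval_eqv (Lrepr t); last exact: LtgyV.
- by move=> a x; rewrite /= mulr_algl mulr_algr.
- exact: LtgK.
- exact: LtgVK.
Qed.

Lemma Leval_zmod_morphism : zmod_morphism (Leval d).
Proof.
elim/quotW=> t; elim/quotW=> s.
rewrite -[X in Leval d X]/(Lplus _ (Lopp (\pi_L s))).
rewrite (LoppE s) LplusE !Leval_pi /=.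
by rewrite scaleN1r mulN1r.
Qed.
HB.instance Definition _ :=
  GRing.isZmodMorphism.Build L A (Leval d) Leval_zmod_morphism.

Lemma Leval_monoid_morphism : monoid_morphism (Leval d).
Proof.
split; first by rewrite -[X in Leval d X]/Lone Leval_pi /= scale1r.
elim/quotW=> t; elim/quotW=> s.
by rewrite -[X in Leval d X]/(Ltimes _ _) LtimesE !Leval_pi.
Qed.
HB.instance Definition _ :=
  GRing.isMonoidMorphism.Build L A (Leval d) Leval_monoid_morphism.

Lemma Leval_scalable : scalable (Leval d).
Proof.
move=> a; elim/quotW=> t.
by rewrite -[X in Leval d X]/(Lscale _ _) LscaleE !Leval_pi /= mulr_algl.
Qed.
HB.instance Definition _ :=
  GRing.isScalable.Build k L A *:%R (Leval d) Leval_scalable.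

Lemma Leval_g : Leval d Lg = Ltg d. Proof. exact: Leval_pi. Qed.
Lemma Leval_gV : Leval d LgV = LtgV d. Proof. exact: Leval_pi. Qed.
Lemma Leval_y : Leval d Ly = Lty d. Proof. exact: Leval_pi. Qed.

End Eval.
End Algebra.

Section Modules.
Variables (k : fieldType) (A : algType k).

(* An A-module viewed as a k-vector space along k -> A. *)
Definition restr (V : lmodType A) : Type := V.
Section Restriction.
Variable V : lmodType A.
HB.instance Definition _ := GRing.Zmodule.on (restr V).

Definition restr_scale (a : k) (v : restr V) : restr V := (a%:A : A) *: (v : V).

Lemma restr_scaleA a b v :
  restr_scale a (restr_scale b v) = restr_scale (a * b) v.
Proof. by rewrite /restr_scale scalerA mulr_algl scalerA. Qed.
Lemma restr_scale1 : left_id 1 restr_scale.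
Proof. by move=> v; rewrite /restr_scale !scale1r. Qed.
Lemma restr_scaleDr : right_distributive restr_scale +%R.
Proof. by move=> a u v; rewrite /restr_scale scalerDr. Qed.
Lemma restr_scaleDl v : {morph restr_scale^~ v : a b / a + b}.
Proof. by move=> a b; rewrite /restr_scale !scalerDl. Qed.
HB.instance Definition _ := GRing.Zmodule_isLmodule.Build k (restr V)
  restr_scaleA restr_scale1 restr_scaleDr restr_scaleDl.
End Restriction.

(* dim_k V = n; the Prop form of Vector.axiom. *)
Definition has_dim (V : lmodType A) (n : nat) : Prop :=
  exists f : {linear restr V -> 'rV[k]_n}, bijective f.

End Modules.

(* V <> 0 and V = U (+) W, for submodules U and W, only if U = 0 or W = 0. *)
Definition indecomposable (R : pzRingType) (V : lmodType R) : Prop :=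
  (exists v : V, v != 0) /\
  forall U W : {pred V},
    submod_closed U -> submod_closed W ->
    (forall v, exists u w, [/\ u \in U, w \in W & v = u + w]) ->
    (forall v, v \in U -> v \in W -> v = 0) ->
  (forall u, u \in U -> u = 0) \/ (forall w, w \in W -> w = 0).

Definition isomorphic (R : pzRingType) (V W : lmodType R) : Prop :=
  exists f : {linear V -> W}, bijective f.

Definition exactly_one_of3 (P Q R : Prop) : Prop :=
  [\/ [/\ P, ~ Q & ~ R], [/\ ~ P, Q & ~ R] | [/\ ~ P, ~ Q & R]].

(* Matrices act on column vectors from the left. *)
Definition matmod (k : fieldType) (d : Ltriple 'M[k]_2) : Type := 'cV[k]_2.
Section MatrixModule.
Variables (k : fieldType) (d : Ltriple 'M[k]_2).
HB.instance Definition _ := GRing.Zmodule.on (matmod d).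

Definition matmod_scale (u : L k) (v : matmod d) : matmod d :=
  Leval d u *m (v : 'cV[k]_2).

Lemma matmod_scaleA u w v :
  matmod_scale u (matmod_scale w v) = matmod_scale (u * w) v.
Proof. by rewrite /matmod_scale mulmxA rmorphM. Qed.
Lemma matmod_scale1 : left_id 1 matmod_scale.
Proof. by move=> v; rewrite /matmod_scale rmorph1 mul1mx. Qed.
Lemma matmod_scaleDr : right_distributive matmod_scale +%R.
Proof. by move=> a u v; rewrite /matmod_scale mulmxDr. Qed.
Lemma matmod_scaleDl v : {morph matmod_scale^~ v : a b / a + b}.
Proof. by move=> a b; rewrite /matmod_scale rmorphD mulmxDl. Qed.
HB.instance Definition _ := GRing.Zmodule_isLmodule.Build (L k) (matmod d)
  matmod_scaleA matmod_scale1 matmod_scaleDr matmod_scaleDl.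
End MatrixModule.

Section Families.
Variable k : fieldType.

(* The matrix with rows (p, q) and (r, s). *)
Definition mx22 (p q r s : k) : 'M[k]_2 :=
  \matrix_(i < 2, j < 2)
    if i == 0 then (if j == 0 then p else q) else (if j == 0 then r else s).

Lemma mx22M p q r s p' q' r' s' :
  mx22 p q r s * mx22 p' q' r' s' =
  mx22 (p * p' + q * r') (p * q' + q * s') (r * p' + s * r') (r * q' + s * s').
Proof.
apply/matrixP => i j; rewrite !mxE big_ord_recl big_ord1 !mxE /=.
by case: i => [[|[|i]] ilt] //=; case: j => [[|[|j]] jlt].
Qed.

Lemma mx22N p q r s : - mx22 p q r s = mx22 (- p) (- q) (- r) (- s).
Proof. by apply/matrixP => i j; rewrite !mxE; case: ifP; case: ifP. Qed.

Lemma mx22_1 : mx22 1 0 0 1 = 1.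
Proof.
apply/matrixP => i j; rewrite !mxE.
by case: i => [[|[|i]] ilt] //=; case: j => [[|[|j]] jlt].
Qed.

Lemma mx22_unit p q s : p != 0 -> s != 0 -> mx22 p q 0 s \is a GRing.unit.
Proof.
move=> p0 s0; apply/unitrP; exists (mx22 p^-1 (- (p^-1 * q * s^-1)) 0 s^-1).
rewrite !mx22M !(mulr0, mul0r, addr0, add0r) !(mulVf, mulfV) // mulrN !mulrA.
by rewrite mulfV // mul1r addNr mulNr mulfVK // addrN mx22_1.
Qed.

(* The relation is given in the form g y = - y g; g^-1 acts by G^-1. *)
Definition mx_triple (G Y : 'M[k]_2) (uG : G \is a GRing.unit)
    (GY : G * Y = - (Y * G)) : Ltriple 'M[k]_2.
Proof.
by refine (@LTriple _ _ G G^-1 Y (mulrV uG) (mulVr uG) _);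
   rewrite GY mulNr mulrK.
Defined.

Section Family.
Variables (a b : k) (a0 : a != 0).

Definition gU := mx22 a 0 0 (- a).
Definition yU := mx22 0 b 1 0.
Definition gV2 := mx22 a 1 0 a.
Definition yV2 : 'M[k]_2 := 0.
Definition gW := mx22 a 0 0 (- a).
Definition yW := mx22 0 1 0 0.

Lemma gU_unit : gU \is a GRing.unit.
Proof. by rewrite mx22_unit // oppr_eq0. Qed.
Lemma gyU : gU * yU = - (yU * gU).
Proof.
rewrite !mx22M mx22N !(mulr0, mul0r, addr0, add0r, mul1r, mulr1, oppr0).
by rewrite mulrN opprK mulrC.
Qed.
Lemma gV2_unit : gV2 \is a GRing.unit. Proof. exact: mx22_unit. Qed.
Lemma gyV2 : gV2 * yV2 = - (yV2 * gV2).
Proof. by rewrite mulr0 mul0r oppr0. Qed.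
Lemma gW_unit : gW \is a GRing.unit. Proof. exact: gU_unit. Qed.
Lemma gyW : gW * yW = - (yW * gW).
Proof.
rewrite !mx22M mx22N !(mulr0, mul0r, addr0, add0r, mul1r, mulr1, oppr0).
by rewrite opprK.
Qed.

Definition Umod : lmodType (L k) := matmod (mx_triple gU_unit gyU).
Definition V2mod : lmodType (L k) := matmod (mx_triple gV2_unit gyV2).
Definition Wmod : lmodType (L k) := matmod (mx_triple gW_unit gyW).

End Family.
End Families.

(* Main.v *)
(* Since g y = - y g, y maps the a-eigenspace of g to the (-a)-eigenspace.     *)
(* Take an eigenvector e of g, say g e = a e.  If y e <> 0, then (e, y e) is a *)
(* basis of V in which V is U_{a,b} or (b = 0, basis reversed) W_{-a}.         *)
(* If y e = 0, complete e to a basis: either g is not diagonalizable and       *)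
(* y = 0, which is V_a^2, or g is diagonalizable and V is W_a or splits.       *)
(* Conversely, on a direct sum of two lines y = 0 (as 2 a c = 0 whenever       *)
(* g e = a e and y e = c e) and u^2 = 0 implies u = 0 for all u in L.  This    *)
(* rules out U and W, where y <> 0, and V_a^2, where u = g - a is nilpotent.   *)
(* The families are told apart by y^2 <> 0 for U, y = 0 for V^2, and           *)
(* y <> 0 = y^2 for W.                                                         *)

Require Import Defs.
From HB Require Import structures.
From mathcomp Require Import all_boot all_order all_algebra.
From mathcomp Require Import boolp ring.
Import GRing.Theory.
Local Open Scope ring_scope.
Local Open Scope quotient_scope.

(** The argument sketched above is carried out with explicit bases of [V] over [k]. In one
    direction, [dim2_eigenvector] supplies the first basis vector and [indecomposable_family]
    normalises the second. [iso_matmod] turns a basis with prescribed action of g and y into an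
    isomorphism, and [decomposable_lines] excludes bases that split [V]. In the other direction,
    [decomposition_lines] turns a splitting into two stable lines. From these,
    [decomposable_killed_by_y] and [decomposable_semisimple] derive contradictions. What separates
    the families is which elements of L annihilate [V], an isomorphism invariant by
    [isomorphic_annihilated]. *)

(** * Linear algebra over [k] in a two-dimensional [A]-module *)

Section Plane.
Context {k : fieldType} {A : algType k} {V : lmodType A}.
Implicit Types (c a b : k) (u : A) (v e : V).

(** [V] carries only an action of [A], so linear independence over [k] is written with the scalars
    [c%:A]. *)
Definition indep e1 e2 : Prop :=
  forall c1 c2, c1%:A *: e1 + c2%:A *: e2 = 0 -> c1 = 0 /\ c2 = 0.

Lemma scaler_algC c u v : u *: (c%:A *: v) = c%:A *: (u *: v).
Proof. by rewrite !scalerA mulr_algl mulr_algr. Qed.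

Lemma scaler_algM a b v : a%:A *: (b%:A *: v) = (a * b)%:A *: v.
Proof. by rewrite scalerA mulr_algl scalerA. Qed.

Lemma scaler_algV c v : c != 0 -> c^-1%:A *: (c%:A *: v) = v.
Proof. by move=> c0; rewrite scaler_algM mulVf // !scale1r. Qed.

Lemma scaler_alg_eq0 c v : c%:A *: v = 0 -> v != 0 -> c = 0.
Proof.
move=> cv0 /eqP v0; apply/eqP/negP => /negP c0; apply: v0.
by rewrite -(scaler_algV c v c0) cv0 scaler0.
Qed.

Lemma indep_sym e1 e2 : indep e1 e2 -> indep e2 e1.
Proof. by move=> ind c1 c2; rewrite addrC => /ind []. Qed.

Lemma indep_neq0 e1 e2 : indep e1 e2 -> e1 != 0.
Proof.
move=> ind; apply/eqP => e10.
have [/eqP] : (1 : k) = 0 /\ (0 : k) = 0.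
  by apply: ind; rewrite e10 scaler0 !scale0r addr0.
by rewrite oner_eq0.
Qed.

(** A triangular change of basis: [a = 0] only rescales [e1], and [c = 1] only shifts [e2]. *)
Lemma indep_shift c a e1 e2 :
  c != 0 -> indep e1 e2 -> indep (c%:A *: e1) (e2 + a%:A *: e1).
Proof.
move=> c0 ind c1 c2; rewrite scalerDr !scaler_algM addrCA -scalerDl -scalerDl addrC.
move=> /ind [/eqP h c20]; split=> //; move: h.
by rewrite c20 mul0r addr0 mulf_eq0 (negbTE c0) orbF => /eqP.
Qed.

(** Applying [u - b] to a linear relation kills the [e2] term and multiplies the [e1] term by
    [a - b]. *)
Lemma indep_eigen u a b e1 e2 : u *: e1 = a%:A *: e1 -> u *: e2 = b%:A *: e2 ->
  a != b -> e1 != 0 -> e2 != 0 -> indep e1 e2.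
Proof.
move=> ue1 ue2 ab e10 e20 c1 c2 h.
have h1 : (c1 * (a - b))%:A *: e1 = 0.
  have uh : u *: (c1%:A *: e1 + c2%:A *: e2) = 0 by rewrite h scaler0.
  have bh : b%:A *: (c1%:A *: e1 + c2%:A *: e2) = 0 by rewrite h scaler0.
  rewrite -(subrr 0) -{1}uh -bh !scalerDr !(scaler_algC _ u) ue1 ue2.
  rewrite !scaler_algM opprD addrACA (mulrC c2) subrr addr0.
  by rewrite mulrBr !scalerBl (mulrC b).
have c10 : c1 = 0.
  move/scaler_alg_eq0: h1 => /(_ e10)/eqP.
  by rewrite mulf_eq0 subr_eq0 (negbTE ab) orbF => /eqP.
split=> //; apply: scaler_alg_eq0 e20.
by move: h; rewrite c10 !scale0r add0r.
Qed.

Hypothesis dimV : has_dim V 2.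

(** Cramer's rule in the coordinates given by [f], with [D] the determinant of the two vectors. *)
Lemma dim2_span e1 e2 : indep e1 e2 ->
  forall v, exists c1 c2, v = c1%:A *: e1 + c2%:A *: e2.
Proof.
have [f bf] := dimV; have finj := bij_inj bf.
have fZ c v : f (c%:A *: v) = c *: f v by exact: linearZ.
have fD v1 v2 : f (v1 + v2) = f v1 + f v2 by exact: linearD.
have ext (x y : 'rV[k]_2) : x 0 0 = y 0 0 -> x 0 1 = y 0 1 -> x = y.
  move=> h0 h1; apply/rowP => i.
  by case: i => [[|[|i]] ilt] //; [move: h0|move: h1];
     congr (_ = _); congr (fun_of_matrix _ _ _); exact: val_inj.
move=> ind; pose x := f e1; pose y := f e2.
pose D := x 0 0 * y 0 1 - x 0 1 * y 0 0.
have f0 : f 0 = 0 by exact: linear0.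
have D0 : D != 0.
  apply/eqP => D0.
  (* The combination of [e1], [e2] with these coefficients has coordinates 0 and [- D]. Likewise
     below, with coordinates [D] and 0. So [D = 0] would force [e1 = 0]. *)
  have [_ /eqP] : y 0 0 = 0 /\ - x 0 0 = 0.
    apply: ind; apply: finj; rewrite fD !fZ f0 -/x -/y.
    apply: ext; rewrite !mxE; first by ring.
    by rewrite -[RHS]oppr0 -D0 /D; ring.
  rewrite oppr_eq0 => /eqP x00.
  have [_ /eqP] : y 0 1 = 0 /\ - x 0 1 = 0.
    apply: ind; apply: finj; rewrite fD !fZ f0 -/x -/y.
    apply: ext; rewrite !mxE; last by ring.
    by rewrite -D0 /D; ring.
  rewrite oppr_eq0 => /eqP x01.
  case/eqP: (indep_neq0 _ _ ind); apply: finj; rewrite f0 -/x.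
  by apply: ext; rewrite mxE.
move=> v; pose z := f v.
exists ((z 0 0 * y 0 1 - z 0 1 * y 0 0) / D).
exists ((x 0 0 * z 0 1 - x 0 1 * z 0 0) / D).
apply: finj; rewrite fD !fZ -/x -/y -/z.
by apply: ext; rewrite !mxE; move: D0; rewrite /D => D0; field.
Qed.

Lemma dim2_extend e1 : e1 != 0 -> exists e2, indep e1 e2.
Proof.
have [f [g fK gK]] := dimV.
have fZ c v : f (c%:A *: v) = c *: f v by exact: linearZ.
have fD v1 v2 : f (v1 + v2) = f v1 + f v2 by exact: linearD.
have f0 : f 0 = 0 by exact: linear0.
move=> e10; have : f e1 != 0.
  by apply: contra e10 => /eqP h; rewrite -(fK e1) h -f0 fK.
(* [i] is the other index; the basis vector there completes [e1], whose [j]-th coordinate is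
   nonzero. *)
case/rV0Pn => j fj; pose i : 'I_2 := 1 - j.
have ij : (j == i) = false by rewrite /i; case: j {fj} @i => [[|[|j]] jlt].
exists (g (delta_mx 0 i)) => c1 c2 /(congr1 f); rewrite fD !fZ gK f0 => h.
have c10 : c1 = 0.
  move/rowP/(_ j): h; rewrite !mxE eqxx ij mulr0 addr0 => /eqP.
  by rewrite mulf_eq0 (negbTE fj) orbF => /eqP.
split=> //; move/rowP/(_ i): h.
by rewrite c10 !mxE !eqxx mulr1 mul0r add0r.
Qed.

(** Comparing [e2]-coordinates in [u *: v = a%:A *: v] leaves [c2 * (b - a) = 0]. *)
Lemma dim2_eigenline u a b e1 e2 v : indep e1 e2 ->
    u *: e1 = a%:A *: e1 -> u *: e2 = b%:A *: e2 -> a != b ->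
    u *: v = a%:A *: v ->
  exists c, v = c%:A *: e1.
Proof.
move=> ind ue1 ue2 ab; have [c1 [c2 ->]] := dim2_span _ _ ind v.
rewrite !scalerDr !(scaler_algC _ u) ue1 ue2 !scaler_algM (mulrC c1).
move=> /addrI /eqP; rewrite -subr_eq0 -!scalerBl => /eqP h.
exists c1; suff -> : c2 = 0 by rewrite !scale0r addr0.
have /eqP : c2 * b - a * c2 = 0.
  exact: scaler_alg_eq0 h (indep_neq0 _ _ (indep_sym _ _ ind)).
by rewrite (mulrC a) -mulrBr mulf_eq0 subr_eq0 (eq_sym b) (negbTE ab) orbF => /eqP.
Qed.

Lemma dim2_annihilated u e1 e2 : indep e1 e2 -> u *: e1 = 0 -> u *: e2 = 0 ->
  forall v, u *: v = 0.
Proof.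
move=> ind ue1 ue2 v; have [c1 [c2 ->]] := dim2_span _ _ ind v.
by rewrite scalerDr !(scaler_algC _ u) ue1 ue2 !scaler0 addr0.
Qed.

End Plane.

(** Since [u] commutes with scalars, it becomes an endomorphism of row vectors, whose characteristic
    polynomial has degree 2 and hence a root in [k]. *)
Lemma dim2_eigenvector (k : closedFieldType) (A : algType k) (V : lmodType A)
    (u : A) : has_dim V 2 ->
  exists (a : k) (e : V), e != 0 /\ u *: e = a%:A *: e.
Proof.
move=> [f [g fK gK]].
have fZ (c : k) (v : V) : f (c%:A *: v) = c *: f v by exact: linearZ.
have fD (v w : V) : f (v + w) = f v + f w by exact: linearD.
have f0 : f 0 = 0 by exact: linear0.
have gl (c : k) x y : g (c *: x + y) = c%:A *: (g x : V) + g y.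
  by apply: (can_inj fK); rewrite fD fZ !gK.
pose h x := f (u *: (g x : V)).
have hl : linear h.
  by move=> c x y; rewrite /h gl scalerDr scaler_algC fD fZ.
pose hL : {linear _ -> _} := HB.pack h (GRing.isLinear.Build _ _ _ _ h hl).
have /closed_rootP [a] : size (char_poly (lin1_mx hL)) != 1%N.
  by rewrite size_char_poly.
rewrite -eigenvalue_root_char => /eigenvalueP [x xa x0].
exists a, (g x); split.
  by apply: contra x0 => /eqP gx; rewrite -(gK x) gx f0.
apply: (can_inj fK); rewrite fZ gK.
by rewrite -xa mul_rV_lin1.
Qed.

(** * Isomorphisms and annihilators *)

Section Isomorphisms.
Context {R : pzRingType} {V W : lmodType R}.

Lemma isomorphic_sym : isomorphic V W -> isomorphic W V.
Proof.
move=> [f [g fK gK]].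
have gl : linear g by exact: can2_linear fK gK.
pose gL : {linear W -> V} := HB.pack g (GRing.isLinear.Build _ _ _ _ g gl).
by exists gL; exists f.
Qed.

Lemma isomorphic_annihilated (u : R) : isomorphic V W ->
  (forall v : V, u *: v = 0) <-> (forall w : W, u *: w = 0).
Proof.
move=> [f [g fK gK]].
have fZ v : f (u *: v) = u *: f v by exact: linearZ.
split=> h x; first by rewrite -(gK x) -fZ h linear0.
by apply: (can_inj fK); rewrite fZ h linear0.
Qed.

End Isomorphisms.

(** * The algebra L and its matrix modules *)

Section LTheory.
Context {k : fieldType}.

(** Structural induction on a term representing the class, so that claims about all of L are checked
    on scalars and generators. *)
Lemma L_ind (P : L k -> Prop) :
    (forall c : k, P c%:A) -> P (Lg k) -> P (LgV k) -> P (Ly k) ->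
    (forall u v, P u -> P v -> P (u + v)) ->
    (forall u v, P u -> P v -> P (u * v)) ->
  forall u, P u.
Proof.
move=> Pc Pg PV Py PD PM; elim/quotW; elim=> //.
- move=> c; suff -> : \pi_(L k) (Lcst c) = c%:A by [].
  rewrite -[RHS]/(Lscale c (Lone k)) LscaleE; apply/LpiP.
  apply: Leqv_sym; apply: Leqv_trans (Leqv_cstM _ _) _.
  by rewrite mulr1; exact: Leqv_refl.
- by move=> t Pt s Ps; rewrite -LplusE; exact: PD.
- by move=> t Pt s Ps; rewrite -LtimesE; exact: PM.
Qed.

Lemma Lgy : Lg k * Ly k = - (Ly k * Lg k).
Proof. by rewrite -mulNr -LgyV -!mulrA LgVK mulr1. Qed.

Lemma Lg_inj {V : lmodType (L k)} (v : V) : Lg k *: v = 0 -> v = 0.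
Proof.
move=> h; have -> : v = (LgV k * Lg k) *: v by rewrite LgVK scale1r.
by rewrite -scalerA h scaler0.
Qed.

(** A matrix is recovered, column by column, from its action on the basis vectors. *)
Lemma matmod_annihilated (d : Ltriple 'M[k]_2) (u : L k) :
  Leval d u = 0 <-> (forall v : matmod d, u *: v = 0).
Proof.
split=> [h v|h]; first by rewrite -[LHS]/(Leval d u *m _) h mul0mx.
apply/matrixP => i j; have /matrixP /(_ i 0) := h (delta_mx j 0).
by rewrite -[u *: _]/(Leval d u *m _) -colE !mxE.
Qed.

Lemma mulmx2E (M : 'M[k]_2) (v : 'cV[k]_2) i :
  (M *m v) i 0 = M i 0 * v 0 0 + M i 1 * v 1 0.
Proof.
rewrite mxE big_ord_recl big_ord1.
by have -> : lift ord0 ord0 = 1 :> 'I_2 by exact: val_inj.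
Qed.

(** The hypotheses say that [Ltg d] and [Lty d] are the matrices of g and y in the basis [e1], [e2].
    The inverse isomorphism sends a column to the combination with these coordinates. *)
Lemma iso_matmod (V : lmodType (L k)) (d : Ltriple 'M[k]_2) (e1 e2 : V) :
    has_dim V 2 -> indep e1 e2 ->
    Lg k *: e1 = (Ltg d 0 0)%:A *: e1 + (Ltg d 1 0)%:A *: e2 ->
    Lg k *: e2 = (Ltg d 0 1)%:A *: e1 + (Ltg d 1 1)%:A *: e2 ->
    Ly k *: e1 = (Lty d 0 0)%:A *: e1 + (Lty d 1 0)%:A *: e2 ->
    Ly k *: e2 = (Lty d 0 1)%:A *: e1 + (Lty d 1 1)%:A *: e2 ->
  isomorphic V (matmod d).
Proof.
move=> dimV ind ge1 ge2 ye1 ye2; apply: isomorphic_sym.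
pose h (v : matmod d) : V :=
  ((v : 'cV[k]_2) 0 0)%:A *: e1 + ((v : 'cV[k]_2) 1 0)%:A *: e2.
have hD v w : h (v + w) = h v + h w.
  by rewrite /h !mxE !scalerDl addrACA.
have hM (M : 'M[k]_2) (u : L k) :
    u *: e1 = (M 0 0)%:A *: e1 + (M 1 0)%:A *: e2 ->
    u *: e2 = (M 0 1)%:A *: e1 + (M 1 1)%:A *: e2 ->
  forall v, h (M *m (v : 'cV[k]_2)) = u *: h v.
  move=> ue1 ue2 v; rewrite /h scalerDr !(scaler_algC _ u) ue1 ue2 !scalerDr.
  rewrite !mulmx2E !scalerDl !scaler_algM addrACA.
  by rewrite !(mulrC (M _ _)).
have hZ u : forall v, h (u *: v) = u *: h v.
  elim/L_ind: u.
  - move=> c; apply: (hM (Leval d c%:A)).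
      by rewrite linearZ rmorph1 !mxE !mulr1 mulr0 !scale0r addr0.
    by rewrite linearZ rmorph1 !mxE !mulr1 mulr0 !scale0r add0r.
  - by move=> v; rewrite -[_ *: _]/(Leval d _ *m _) Leval_g; exact: hM.
  (* No matrix identity is assumed for the inverse of g: its compatibility with [h] is deduced from
     that of g by inserting [LgV k * Lg k = 1]. *)
  - move=> v; have -> x : h x = LgV k *: (Lg k *: h x).
      by rewrite scalerA LgVK scale1r.
    congr (_ *: _); rewrite -(hM (Ltg d)) // -Leval_g.
    by rewrite -[_ *m _]/(Lg k *: (LgV k *: v)) scalerA LgK scale1r.
  - by move=> v; rewrite -[_ *: _]/(Leval d _ *m _) Leval_y; exact: hM.
  - by move=> u w hu hw v; rewrite !scalerDl hD hu hw.
  - by move=> u w hu hw v; rewrite -!scalerA hu hw.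
have hl : linear h by move=> c v w; rewrite hD hZ.
pose hL : {linear matmod d -> V} := HB.pack h (GRing.isLinear.Build _ _ _ _ h hl).
exists hL.
have sp v : exists x, h x = v.
  have [c1 [c2 ->]] := dim2_span dimV _ _ ind v.
  by exists (\col_i if i == 0 then c1 else c2); rewrite /h !mxE.
have hinj : injective h.
  move=> v w /eqP; rewrite -subr_eq0 => /eqP vw.
  have [v0 v1] : (v : 'cV[k]_2) 0 0 = (w : 'cV[k]_2) 0 0 /\
                 (v : 'cV[k]_2) 1 0 = (w : 'cV[k]_2) 1 0.
    have [] := ind ((v : 'cV[k]_2) 0 0 - (w : 'cV[k]_2) 0 0)
                   ((v : 'cV[k]_2) 1 0 - (w : 'cV[k]_2) 1 0).
      by rewrite !scalerBl addrACA -opprD.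
    by move=> /eqP; rewrite subr_eq0 => /eqP -> /eqP; rewrite subr_eq0 => /eqP ->.
  apply/colP => i.
  by case: i => [[|[|i]] ilt] //; [move: v0|move: v1];
     congr (_ = _); congr (fun_of_matrix _ _ _); exact: val_inj.
exists (fun v => projT1 (cid (sp v))) => v /=; last exact: projT2 (cid (sp v)).
by apply: hinj; exact: projT2 (cid (sp _)).
Qed.

End LTheory.

(** * Direct sum decompositions into lines *)

Section Decompositions.
Context {k : fieldType} {V : lmodType (L k)}.
Hypothesis dimV : has_dim V 2.
Implicit Types (e : V) (u : L k).

Lemma Lg_eigenvalue_neq0 (a : k) e : e != 0 -> Lg k *: e = a%:A *: e -> a != 0.
Proof.
move=> /eqP e0 ge; apply/eqP => a0; apply: e0; apply: Lg_inj.
by rewrite ge a0 !scale0r.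
Qed.

Lemma eigenline_stable (a c : k) e : e != 0 ->
    Lg k *: e = a%:A *: e -> Ly k *: e = c%:A *: e ->
  forall u, exists b : k, u *: e = b%:A *: e.
Proof.
move=> e0 ge ye; have a0 := Lg_eigenvalue_neq0 _ _ e0 ge.
move=> u; elim/(@L_ind k): u; [by move=> b; exists b|by exists a| |by exists c| |].
(* Write [e] as [a^-1 * a] times itself and read [a%:A *: e] as [Lg k *: e], which [LgV k]
   cancels. *)
- exists a^-1; rewrite -[in LHS](scaler_algV a e a0) scaler_algC -ge (scalerA (LgV k)).
  by rewrite LgVK scale1r.
- by move=> u v [b ub] [d vd]; exists (b + d); rewrite !scalerDl ub vd.
- move=> u v [b ub] [d vd]; exists (d * b).
  by rewrite -scalerA vd scaler_algC ub scaler_algM.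
Qed.

(** The two stable lines are nonzero submodules; they span [V] by dimension and meet in 0 by
    independence. *)
Lemma decomposable_lines e1 e2 : indep e1 e2 ->
    (forall u, exists c : k, u *: e1 = c%:A *: e1) ->
    (forall u, exists c : k, u *: e2 = c%:A *: e2) ->
  ~ indecomposable V.
Proof.
move=> ind st1 st2 [_ /(_ (fun v => `[< exists c : k, v = c%:A *: e1 >])
                          (fun v => `[< exists c : k, v = c%:A *: e2 >])) dec].
have closed e : (forall u, exists c : k, u *: e = c%:A *: e) ->
    GRing.submod_closed
      ((fun v => `[< exists c : k, v = c%:A *: e >]) : {pred V}).
  move=> st; split; first by apply/asboolP; exists 0; rewrite !scale0r.
  move=> u v w /asboolP [c ->] /asboolP [d ->]; apply/asboolP.
  have [b ub] := st u; exists (c * b + d).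
  by rewrite scaler_algC ub scaler_algM !scalerDl.
case: dec; [exact: closed|exact: closed| | | |].
- move=> v; have [c1 [c2 ->]] := dim2_span dimV _ _ ind v.
  exists (c1%:A *: e1), (c2%:A *: e2).
  by split=> //; apply/asboolP; [exists c1|exists c2].
- move=> v /asboolP [c ->] /asboolP [d /eqP]; rewrite -subr_eq0 => /eqP.
  rewrite -scaleNr -scaleNr => /ind [-> _].
  by rewrite !scale0r.
- move=> /(_ e1) h; case/eqP: (indep_neq0 _ _ ind); apply: h.
  by apply/asboolP; exists 1; rewrite !scale1r.
- move=> /(_ e2) h; case/eqP: (indep_neq0 _ _ (indep_sym _ _ ind)); apply: h.
  by apply/asboolP; exists 1; rewrite !scale1r.
Qed.

(** As [V] is nonzero, it must split. Nonzero vectors of the two summands are independent because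
    the summands meet in 0, so they form a basis. *)
Lemma decomposition_lines : (exists v : V, v != 0) -> ~ indecomposable V ->
  exists e1 e2 : V, [/\ indep e1 e2,
    forall u, exists c : k, u *: e1 = c%:A *: e1 &
    forall u, exists c : k, u *: e2 = c%:A *: e2].
Proof.
move=> nz; rewrite /indecomposable => /not_andP [//|].
move=> /existsNP [U] /existsNP [W] /not_implyP [[U0 Ucl]] /not_implyP [[W0 Wcl]].
move=> /not_implyP [_] /not_implyP [disj] /not_orP [].
move=> /existsNP [e1] /not_implyP [Ue1 /eqP e10].
move=> /existsNP [e2] /not_implyP [We2 /eqP e20].
have US u v : v \in U -> u *: v \in U.
  by move=> Uv; rewrite -[_ *: _]addr0; exact: Ucl.
have WS u v : v \in W -> u *: v \in W.
  by move=> Wv; rewrite -[_ *: _]addr0; exact: Wcl.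
have ind : indep e1 e2.
  move=> c1 c2 h.
  have c1e1 : c1%:A *: e1 = 0.
    apply: disj; first exact: US.
    by move/eqP: h; rewrite addr_eq0 -scaleNr => /eqP ->; exact: WS.
  split; first exact: scaler_alg_eq0 e10.
  by apply: scaler_alg_eq0 e20; rewrite -h c1e1 add0r.
exists e1, e2; split=> // u.
  have [a [b ueq]] := dim2_span dimV _ _ ind (u *: e1); exists a.
  (* This [e2]-component lies in [W], and also in [U], being the difference of [u *: e1] and a
     multiple of [e1]. *)
  suff be2 : b%:A *: e2 = 0 by rewrite ueq be2 addr0.
  apply: disj; last exact: WS.
  have -> : b%:A *: e2 = (- a%:A) *: e1 + u *: e1.
    by rewrite ueq scaleNr addKr.
  by apply: Ucl => //; exact: US.
have [a [b ueq]] := dim2_span dimV _ _ ind (u *: e2); exists b.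
suff ae1 : a%:A *: e1 = 0 by rewrite ueq ae1 add0r.
apply: disj; first exact: US.
have -> : a%:A *: e1 = (- b%:A) *: e2 + u *: e2.
  by rewrite ueq scaleNr addrC addrK.
by apply: Wcl => //; exact: WS.
Qed.

Hypothesis two_neq0 : 2%:R != 0 :> k.

(** The relation gy + yg = 0 applied to [e] gives 2ac = 0, where 2 and [a] are nonzero. *)
Lemma eigenline_killed_by_y (a c : k) e : e != 0 ->
  Lg k *: e = a%:A *: e -> Ly k *: e = c%:A *: e -> Ly k *: e = 0.
Proof.
move=> e0 ge ye; have a0 := Lg_eigenvalue_neq0 _ _ e0 ge.
have : (a * c + c * a)%:A *: e = 0.
  rewrite !scalerDl -!scaler_algM -ge -ye -!scaler_algC -ge -ye.
  by rewrite !scalerA -scalerDl Lgy subrr scale0r.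
have -> : a * c + c * a = 2%:R * a * c by ring.
move=> /scaler_alg_eq0 /(_ e0) /eqP; rewrite !mulf_eq0.
by rewrite (negbTE two_neq0) (negbTE a0) /= ye => /eqP ->; rewrite !scale0r.
Qed.

Lemma decomposable_killed_by_y : (exists v : V, v != 0) -> ~ indecomposable V ->
  forall v : V, Ly k *: v = 0.
Proof.
move=> nz /(decomposition_lines nz) [e1 [e2 [ind st1 st2]]].
have [[a ge1] [c ye1]] := (st1 (Lg k), st1 (Ly k)).
have [[b ge2] [d ye2]] := (st2 (Lg k), st2 (Ly k)).
apply: (dim2_annihilated dimV _ _ _ ind).
  exact: eigenline_killed_by_y (indep_neq0 _ _ ind) ge1 ye1.
exact: eigenline_killed_by_y (indep_neq0 _ _ (indep_sym _ _ ind)) ge2 ye2.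
Qed.

(** On each stable line [u] acts by a scalar, and a scalar with zero square is zero. *)
Lemma decomposable_semisimple (u : L k) :
    (exists v : V, v != 0) -> ~ indecomposable V ->
  (forall v : V, (u * u) *: v = 0) -> forall v : V, u *: v = 0.
Proof.
move=> nz /(decomposition_lines nz) [e1 [e2 [ind st1 st2]]] uu.
have sq (e : V) : e != 0 -> (exists c : k, u *: e = c%:A *: e) -> u *: e = 0.
  move=> e0 [c ue]; have := uu e; rewrite -scalerA ue scaler_algC ue scaler_algM.
  move=> /scaler_alg_eq0 /(_ e0) /eqP; rewrite mulf_eq0 orbb => /eqP ->.
  by rewrite !scale0r.
apply: (dim2_annihilated dimV _ _ _ ind); apply: sq => //.
  exact: indep_neq0 ind.
exact: indep_neq0 (indep_sym _ _ ind).
Qed.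

End Decompositions.

(** * Annihilators that tell the three families apart *)

Section Families.
Context {k : fieldType} {V : lmodType (L k)}.

Lemma iso_matmod_annihilated (d : Ltriple 'M[k]_2) (u : L k) :
  isomorphic V (matmod d) -> Leval d u = 0 <-> (forall v : V, u *: v = 0).
Proof.
move=> iso; apply: iff_trans (matmod_annihilated d u) _.
exact: iff_sym (isomorphic_annihilated u iso).
Qed.

Lemma Umod_yy (a b : k) (a0 : a != 0) : b != 0 -> isomorphic V (Umod b a0) ->
  ~ (forall v : V, (Ly k * Ly k) *: v = 0).
Proof.
move=> b0 iso /(iso_matmod_annihilated _ _ iso).
rewrite rmorphM /= Leval_y => /matrixP /(_ 0 0).
by rewrite /= mx22M !mxE /= mulr1 mul0r add0r => /eqP; rewrite (negbTE b0).
Qed.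

Lemma V2mod_y (a : k) (a0 : a != 0) : isomorphic V (V2mod a0) ->
  forall v : V, Ly k *: v = 0.
Proof. by move=> iso; apply/(iso_matmod_annihilated _ _ iso); rewrite Leval_y. Qed.

(** g - a acts by the nonzero nilpotent matrix [mx22 0 1 0 0]. *)
Lemma V2mod_g (a : k) (a0 : a != 0) : isomorphic V (V2mod a0) ->
  ~ (forall v : V, (Lg k - a%:A) *: v = 0) /\
  (forall v : V, ((Lg k - a%:A) * (Lg k - a%:A)) *: v = 0).
Proof.
move=> iso.
have ev : Leval (mx_triple (gV2_unit a0) (gyV2 a)) (Lg k - a%:A) = mx22 0 1 0 0.
  rewrite rmorphB /= linearZ rmorph1 Leval_g /= /gV2.
  by apply/matrixP => -[[|[|i]] ilt] // -[[|[|j]] jlt] //; rewrite !mxE //=;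
     rewrite ?(mulr1, mulr0, subrr, subr0).
split; first move=> /(iso_matmod_annihilated _ _ iso).
  by rewrite ev => /matrixP /(_ 0 1) /eqP; rewrite !mxE /= oner_eq0.
apply/(iso_matmod_annihilated _ _ iso); rewrite rmorphM /= ev mx22M.
by rewrite !(mulr0, mul0r, addr0); apply/matrixP => i j; rewrite !mxE !if_same.
Qed.

Lemma Wmod_y (a : k) (a0 : a != 0) : isomorphic V (Wmod a0) ->
  ~ (forall v : V, Ly k *: v = 0) /\
  (forall v : V, (Ly k * Ly k) *: v = 0).
Proof.
move=> iso; split; first move=> /(iso_matmod_annihilated _ _ iso).
  by rewrite Leval_y => /matrixP /(_ 0 1) /eqP; rewrite !mxE /= oner_eq0.
apply/(iso_matmod_annihilated _ _ iso); rewrite rmorphM /= Leval_y /= mx22M.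
by rewrite !(mulr0, mul0r, addr0); apply/matrixP => i j; rewrite !mxE !if_same.
Qed.

End Families.

(** * Recognising a family from a basis *)

Section Recognition.
Context {k : fieldType} {V : lmodType (L k)}.
Hypothesis dimV : has_dim V 2.
Context {a : k} (a0 : a != 0) {e1 e2 : V}.
Hypothesis ind : indep e1 e2.

Lemma iso_Umod (b : k) :
    Lg k *: e1 = a%:A *: e1 -> Lg k *: e2 = (- a)%:A *: e2 ->
    Ly k *: e1 = e2 -> Ly k *: e2 = b%:A *: e1 ->
  isomorphic V (Umod b a0).
Proof.
move=> ge1 ge2 ye1 ye2; apply: (iso_matmod _ _ _ _ dimV ind);
  by rewrite /= !mxE /= ?scale0r ?scale0r ?scale1r ?scale1r ?addr0 ?add0r.
Qed.

Lemma iso_V2mod :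
    Lg k *: e1 = a%:A *: e1 -> Lg k *: e2 = e1 + a%:A *: e2 ->
    (forall v : V, Ly k *: v = 0) ->
  isomorphic V (V2mod a0).
Proof.
move=> ge1 ge2 y0; apply: (iso_matmod _ _ _ _ dimV ind);
  by rewrite /= !mxE /= ?scale0r ?scale0r ?scale1r ?scale1r ?addr0 ?add0r ?y0.
Qed.

Lemma iso_Wmod :
    Lg k *: e1 = a%:A *: e1 -> Lg k *: e2 = (- a)%:A *: e2 ->
    Ly k *: e1 = 0 -> Ly k *: e2 = e1 ->
  isomorphic V (Wmod a0).
Proof.
move=> ge1 ge2 ye1 ye2; apply: (iso_matmod _ _ _ _ dimV ind);
  by rewrite /= !mxE /= ?scale0r ?scale0r ?scale1r ?scale1r ?addr0 ?add0r.
Qed.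

End Recognition.

(** * The classification *)

Lemma indecomposable_family (k : closedFieldType) (two_neq0 : 2%:R != 0 :> k)
    (V : lmodType (L k)) (dimV : has_dim V 2) : indecomposable V ->
  [\/ exists (a b : k) (a0 : a != 0), b != 0 /\ isomorphic V (Umod b a0),
      exists (a : k) (a0 : a != 0), isomorphic V (V2mod a0) |
      exists (a : k) (a0 : a != 0), isomorphic V (Wmod a0)].
Proof.
move=> indec.
have neqN (c : k) : c != 0 -> c != - c.
  by move=> c0; rewrite -subr_eq0 opprK -mulr2n -mulr_natl mulf_neq0.
have gy (v : V) : Lg k *: (Ly k *: v) = - (Ly k *: (Lg k *: v)).
  by rewrite !scalerA Lgy scaleNr.
have [a [e1 [e10 ge1]]] := dim2_eigenvector _ _ _ (Lg k) dimV.
have a0 := Lg_eigenvalue_neq0 _ _ e10 ge1.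
have [ye1|/eqP ye10] := eqVneq (Ly k *: e1) 0; last first.
  have gye1 : Lg k *: (Ly k *: e1) = (- a)%:A *: (Ly k *: e1).
    by rewrite gy ge1 scaler_algC !scaleNr.
  have ind := indep_eigen _ _ _ _ _ ge1 gye1 (neqN a a0) e10 (introN eqP ye10).
  (* g commutes with the square of y, so this vector stays in the [a]-eigenspace of g, which is the
     line of [e1]. *)
  have [b yye1] : exists b : k, Ly k *: (Ly k *: e1) = b%:A *: e1.
    apply: (dim2_eigenline dimV _ _ _ _ _ _ ind ge1 gye1 (neqN a a0)).
    by rewrite gy gye1 scaler_algC !scaleNr opprK.
  have [b0|b0] := eqVneq b 0; last first.
    apply: Or31; exists a, b, a0; split=> //; exact: iso_Umod ind _ ge1 gye1 _ yye1.
  (* Here y kills [Ly k *: e1], so that vector comes first in the basis, with eigenvalue [- a]. *)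
  apply: Or33; have Na0 : - a != 0 by rewrite oppr_eq0.
  exists (- a), Na0; apply: (iso_Wmod dimV Na0 (indep_sym _ _ ind)) => //.
    by rewrite opprK.
  by rewrite yye1 b0 !scale0r.
have [e2 ind] := dim2_extend dimV _ e10.
(* The two coordinates of (gy + yg)v = 0, given that y kills [e1]. *)
have rel (v : V) (c d p q : k) : indep e1 v ->
    Lg k *: v = c%:A *: e1 + d%:A *: v -> Ly k *: v = p%:A *: e1 + q%:A *: v ->
    p * a + (q * c + d * p) = 0 /\ q * d + d * q = 0.
  move=> ind' gv yv; apply: ind'.
  transitivity (Lg k *: (Ly k *: v) + Ly k *: (Lg k *: v)).
    rewrite yv gv !scalerDr !(scaler_algC _ (Lg k)) !(scaler_algC _ (Ly k)).
    rewrite ge1 gv ye1 yv scaler0 add0r !scalerDr !scaler_algM !scalerDl.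
    by rewrite -!addrA; do 2 congr (_ + _); rewrite addrCA.
  by rewrite gy addNr.
have q_eq0 (q d : k) : d != 0 -> q * d + d * q = 0 -> q = 0.
  move=> d0; have -> : q * d + d * q = 2%:R * d * q by ring.
  by move/eqP; rewrite !mulf_eq0 (negbTE two_neq0) (negbTE d0) => /eqP.
have [c [d ge2]] := dim2_span dimV _ _ ind (Lg k *: e2).
have [da|da] := eqVneq d a.
  rewrite {d}da in ge2.
  have ye2 : Ly k *: e2 = 0.
    have [p [q ye2]] := dim2_span dimV _ _ ind (Ly k *: e2).
    have [r1 /(q_eq0 _ _ a0) q0] := rel _ _ _ _ _ ind ge2 ye2.
    move: r1; rewrite q0 mul0r add0r => /(q_eq0 _ _ a0) p0.
    by rewrite ye2 q0 p0 !scale0r addr0.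
  have y0 := dim2_annihilated dimV _ _ _ ind ye1 ye2.
  have yline (v : V) : Ly k *: v = 0%:A *: v by rewrite y0 !scale0r.
  apply: Or32; exists a, a0.
  (* With y acting as 0, g has matrix rows (a, c), (0, a): split if [c = 0], otherwise a Jordan
     block once [e1] is rescaled by [c]. *)
  have [c0|c0] := eqVneq c 0.
    case: (decomposable_lines dimV _ _ ind _ _ indec).
      exact: eigenline_stable e10 ge1 (yline _).
    apply: eigenline_stable (indep_neq0 _ _ (indep_sym _ _ ind)) _ (yline _).
    by rewrite ge2 c0 !scale0r add0r.
  apply: (iso_V2mod dimV a0 (e1 := c%:A *: e1) (e2 := e2)) => //.
    by have := indep_shift c 0 _ _ c0 ind; rewrite !scale0r addr0.
  by rewrite scaler_algC ge1 !scaler_algM mulrC.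
(* The shift is the one that makes [f] an eigenvector of g for [d]. *)
pose f := e2 + (c / (d - a))%:A *: e1.
have indf : indep e1 f.
  by have := indep_shift 1 (c / (d - a)) _ _ (oner_neq0 _) ind; rewrite !scale1r.
have gf : Lg k *: f = 0%:A *: e1 + d%:A *: f.
  rewrite !scale0r add0r /f !scalerDr scaler_algC ge1 ge2 !scaler_algM.
  rewrite addrAC addrC -scalerDl -scalerDl; congr (_ + _%:A *: _).
  by field; rewrite subr_eq0.
have gf' : Lg k *: f = d%:A *: f by rewrite gf !scale0r add0r.
have f0 := indep_neq0 _ _ (indep_sym _ _ indf).
have d0 := Lg_eigenvalue_neq0 _ _ f0 gf'.
have [p [q yf]] := dim2_span dimV _ _ indf (Ly k *: f).
have [r1 /(q_eq0 _ _ d0) q0] := rel _ _ _ _ _ indf gf yf.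
rewrite {}q0 !scale0r addr0 in yf.
have [p0|p0] := eqVneq p 0.
  case: (decomposable_lines dimV _ _ indf _ _ indec).
    by apply: eigenline_stable e10 ge1 (_ : _ = 0%:A *: _); rewrite !scale0r.
  by apply: eigenline_stable f0 gf' (_ : _ = 0%:A *: _); rewrite yf p0 !scale0r.
(* The first relation now reads [d * p + p * a = 0] up to order, with [p] nonzero. *)
have /eqP dNa : d == - a.
  move/eqP: r1; rewrite mulr0 add0r (mulrC d) -mulrDr mulf_eq0 (negbTE p0) /=.
  by rewrite addrC addr_eq0.
apply: Or33; exists a, a0.
apply: (iso_Wmod dimV a0 (e1 := p%:A *: e1) (e2 := f)) => //.
- by have := indep_shift p 0 _ _ p0 indf; rewrite !scale0r addr0.
- by rewrite scaler_algC ge1 !scaler_algM mulrC.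
- by rewrite -dNa.
- by rewrite scaler_algC ye1 scaler0.
Qed.

Theorem proposition2p15 (k : closedFieldType) (chark0 : [pchar k] =i pred0)
    (V : lmodType (L k)) (dimV : has_dim V 2) :
  indecomposable V <->
  exactly_one_of3
    (exists (a b : k) (a0 : a != 0), b != 0 /\ isomorphic V (Umod b a0))
    (exists (a : k) (a0 : a != 0), isomorphic V (V2mod a0))
    (exists (a : k) (a0 : a != 0), isomorphic V (Wmod a0)).
Proof.
have two_neq0 : 2%:R != 0 :> k by rewrite ((pcharf0P k).1 chark0).
set isoU := exists a b, _; set isoV := exists a a0, isomorphic V (V2mod _).
set isoW := exists a a0, _.
have Uyy : isoU -> ~ (forall v : V, (Ly k * Ly k) *: v = 0).
  by move=> [a [b [a0 [b0 iso]]]]; exact: Umod_yy b0 iso.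
have Vy : isoV -> forall v : V, Ly k *: v = 0.
  by move=> [a [a0 iso]]; exact: V2mod_y iso.
have Wy : isoW -> ~ (forall v : V, Ly k *: v = 0) by move=> [a [a0 /Wmod_y []]].
have Wyy : isoW -> forall v : V, (Ly k * Ly k) *: v = 0.
  by move=> [a [a0 /Wmod_y []]].
have Vyy : isoV -> forall v : V, (Ly k * Ly k) *: v = 0.
  by move=> /Vy y0 v; rewrite -scalerA y0.
split.
  case/(indecomposable_family _ two_neq0 _ dimV) => [U|V2|W].
  - by apply: Or31; split=> // [/Vyy|/Wyy]; exact: Uyy.
  - by apply: Or32; split=> // [/Uyy|/Wy]; [apply; exact: Vyy|apply; exact: Vy].
  - by apply: Or33; split=> // [/Uyy|/Vy]; [apply; exact: Wyy|exact: Wy].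
(* In each family some element of L acts nontrivially; this supplies the nonzero vector needed to
   turn decomposability into stable lines. *)
have nonzero (u : L k) : ~ (forall v : V, u *: v = 0) -> exists v : V, v != 0.
  move=> /existsNP [v uv]; exists v; apply/eqP => v0.
  by apply: uv; rewrite v0 scaler0.
move=> fam; apply: contrapT => dec.
case: fam => [[/Uyy U _ _]|[_ V2 _]|[_ _ W]].
- apply: (U) => v; rewrite -scalerA.
  by rewrite (decomposable_killed_by_y dimV two_neq0 (nonzero _ U) dec).
- have [a [a0 /V2mod_g [nss sq]]] := V2; apply: (nss).
  exact: decomposable_semisimple dimV _ (nonzero _ nss) dec sq.
- apply: (Wy W); exact: decomposable_killed_by_y dimV two_neq0 (nonzero _ (Wy W)) dec.
Qed.
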